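(* Let $K$ be an $(\mathbb{F}_q,\mathbb{Z})$-field and let $X\subseteq K^{k+r}$ be $\mathcal{L}_{\mathrm{aff}}^K$-definable. Let $\pi_k:K^{k+r}\to K^k$ be the projection onto the first $k$ coordinates. Then there exists an $\mathcal{L}_{\mathrm{aff}}^K$-definable function $g:\pi_k(X)\to X$ with $\pi_k\circ g=\mathrm{Id}_{\pi_k(X)}$.
   Context: An $(\mathbb{F}_q,\mathbb{Z})$-field is a valued field $K$ (valuation $\mathrm{ord}$, $\mathrm{ord}\,0=\infty$, valuation ring $R_K$; not necessarily Henselian, any characteristic) whose residue field is isomorphic to $\mathbb{F}_q$ and whose value group is elementarily equivalent to $\mathbb{Z}$. Fix $\pi\in K$ of smallest positive order, $\mathrm{ord}\,\pi=1$. For $m\ge1$, $\mathrm{ac}_{\pi^m}:K^\times\to(R_K/\pi^mR_K)^\times$ is the unique group homomorphism with $\mathrm{ac}_{\pi^m}(\pi)=1$ and $\mathrm{ac}_{\pi^m}(u)\equiv u\bmod\pi^m$ for units $u$. For $n,m\ge1$, $\Lambda_{n,m}$ is the quotient of $K$ by: $x\sim y$ iff $x=y=0$, or $x,y\ne0$, $\mathrm{ord}\,x\equiv\mathrm{ord}\,y\bmod n$ and $\mathrm{ac}_{\pi^m}(x)=\mathrm{ac}_{\pi^m}(y)$; $\rho_{n,m}:K\to\Lambda_{n,m}$ is the quotient map. The one-sorted language $\mathcal{L}_{\mathrm{aff}}^K$ consists of $+,-$, scalar multiplications $\bar c:x\mapsto cx$ for all $c\in K$, the relation $x\mid y\iff\mathrm{ord}\,x\le\mathrm{ord}\,y$,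 and ternary relations $R_{n,m}(x,y,z)\iff\rho_{n,m}(y-x)=\rho_{n,m}(z)$ ($n,m\ge1$); parameters from $K$ are allowed. *)

(* Defs.v *)
From HB Require Import structures.
From mathcomp Require Import all_boot all_order all_algebra.
Set Implicit Arguments. Unset Strict Implicit. Unset Printing Implicit Defensive.
Import Order.TTheory GRing.Theory Num.Theory.
Local Open Scope ring_scope.

(* A Z-group (model of Presburger arithmetic): a totally ordered abelian
   group (G,+,<=), discretely ordered with a least positive element e, such
   that G/nG has the n classes e*0, ..., e*(n-1) for every n >= 1.  These are
   exactly the ordered abelian groups elementarily equivalent to Z. *)
Definition ZGroup (G : zmodType) (le : rel G) : Prop :=
  [/\ (forall x, le x x) /\
      (forall x y z, le x y -> le y z -> le x z),
      (forall x y, le x y -> le y x -> x = y),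
      (forall x y, le x y \/ le y x),
      (forall x y z, le x y -> le (x + z) (y + z))
    & exists e : G,
      [/\ le 0 e, e <> 0,
          (forall x, le 0 x -> x <> 0 -> le e x)
        & (forall n : nat, (0 < n)%N -> forall x : G,
             exists (y : G) (i : nat), (i < n)%N /\ x = y *+ n + e *+ i)]].

(* ---------- values with infinity (None = +oo) ---------- *)
Definition ole (G : zmodType) (le : rel G) (a b : option G) : bool :=
  match a, b with
  | _, None => true
  | None, Some _ => false
  | Some a, Some b => le a b
  end.

Definition oadd (G : zmodType) (a b : option G) : option G :=
  match a, b with
  | Some a, Some b => Some (a + b)
  | _, _ => None
  end.

Section FqZ.
Variables (K : fieldType) (G : zmodType) (le : rel G) (ord : K -> option G).

Definition is_valuation : Prop :=
  [/\ (forall x, ord x = None <-> x = 0),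
      (forall x y, ord (x * y) = oadd (ord x) (ord y)),
      (forall x y, ole le (ord x) (ord (x + y)) || ole le (ord y) (ord (x + y)))
    & (forall g : G, exists x : K, ord x = Some g)].

Definition in_RK (x : K) : bool := ole le (Some 0) (ord x).

(* The residue field R_K / m_K is isomorphic to the field with q elements:
   there is a surjective ring morphism from R_K onto a finite field with q
   elements whose kernel is the maximal ideal m_K. *)
Definition residue_field_Fq (q : nat) : Prop :=
  exists (F : finFieldType) (res : K -> F),
    [/\ #|F| = q /\
        res 1 = 1,
        (forall x y, in_RK x -> in_RK y -> res (x + y) = res x + res y),
        (forall x y, in_RK x -> in_RK y -> res (x * y) = res x * res y),
        (forall a : F, exists x, in_RK x /\ res x = a)
      & (forall x, in_RK x -> (res x = 0 <-> ~~ ole le (ord x) (Some 0)))].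

Definition FqZField (q : nat) : Prop :=
  [/\ ZGroup le, is_valuation & residue_field_Fq q].

Definition uniformizer (pi : K) : Prop :=
  exists e : G, [/\ ord pi = Some e, le 0 e, e <> 0 &
                    forall g, le 0 g -> g <> 0 -> le e g].

Variable pi : K.

Definition congr_pim (m : nat) (a b : K) : bool :=
  ole le (ord (pi ^+ m)) (ord (a - b)).

(* ac : K -> K is (a choice of representatives in R_K^x of) a group
   homomorphism K^x -> (R_K/pi^m R_K)^x with ac(pi) = 1 and ac(u) = u mod pi^m
   for units u.  Such a homomorphism is unique (as a map to the quotient). *)
Definition ac_spec (m : nat) (ac : K -> K) : Prop :=
  [/\ (forall x, x != 0 -> ord (ac x) = Some 0),
      (forall x y, x != 0 -> y != 0 -> congr_pim m (ac (x * y)) (ac x * ac y)),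
      congr_pim m (ac pi) 1
    & (forall u, ord u = Some 0 -> congr_pim m (ac u) u)].

Definition rho_eq (n m : nat) (x y : K) : Prop :=
  (x = 0 /\ y = 0) \/
  [/\ x != 0, y != 0,
      (exists (a b z : G), [/\ ord x = Some a, ord y = Some b & a - b = z *+ n])
    & (forall ac, ac_spec m ac -> congr_pim m (ac x) (ac y))].

Inductive term : Type :=
  | TVar of nat
  | TConst of K
  | TAdd of term & term
  | TSub of term & term
  | TScal of K & term.

Inductive formula : Type :=
  | FEq of term & term
  | FDiv of term & term
  | FR of nat & nat & term & term & term (* FR n m : R_{n+1,m+1} *)
  | FNot of formula
  | FAnd of formula & formula
  | FOr of formula & formula
  | FEx of nat & formula
  | FAll of nat & formula.

Fixpoint teval (e : nat -> K) (t : term) : K :=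
  match t with
  | TVar i => e i
  | TConst c => c
  | TAdd t1 t2 => teval e t1 + teval e t2
  | TSub t1 t2 => teval e t1 - teval e t2
  | TScal c t1 => c * teval e t1
  end.

Definition upd (e : nat -> K) (i : nat) (a : K) : nat -> K :=
  fun j => if j == i then a else e j.

Fixpoint sat (e : nat -> K) (f : formula) : Prop :=
  match f with
  | FEq t1 t2 => teval e t1 = teval e t2
  | FDiv t1 t2 => ole le (ord (teval e t1)) (ord (teval e t2))
  | FR n m t1 t2 t3 => rho_eq n.+1 m.+1 (teval e t2 - teval e t1) (teval e t3)
  | FNot f1 => ~ sat e f1
  | FAnd f1 f2 => sat e f1 /\ sat e f2
  | FOr f1 f2 => sat e f1 \/ sat e f2
  | FEx i f1 => exists a : K, sat (upd e i a) f1
  | FAll i f1 => forall a : K, sat (upd e i a) f1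
  end.

Definition tenv (n : nat) (x : n.-tuple K) : nat -> K :=
  fun i => nth 0 x i.

Definition definable (n : nat) (X : n.-tuple K -> Prop) : Prop :=
  exists f : formula, forall x : n.-tuple K, X x <-> sat (tenv x) f.

End FqZ.

Definition proj_k (T : Type) (k r : nat) (x : (k + r).-tuple T) : k.-tuple T :=
  [tuple tnth x (lshift r i) | i < k].

Definition fst_part (T : Type) (a b : nat) (z : (a + b).-tuple T) : a.-tuple T :=
  [tuple tnth z (lshift b i) | i < a].
Definition snd_part (T : Type) (a b : nat) (z : (a + b).-tuple T) : b.-tuple T :=
  [tuple tnth z (rshift a i) | i < b].

Definition proj_set (T : Type) (k r : nat) (X : (k + r).-tuple T -> Prop)
  (y : k.-tuple T) : Prop := exists x, X x /\ proj_k x = y.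

Definition graph_on (T : Type) (k r : nat) (X : (k + r).-tuple T -> Prop)
  (g : k.-tuple T -> (k + r).-tuple T) (z : (k + (k + r)).-tuple T) : Prop :=
  proj_set X (fst_part z) /\ snd_part z = g (fst_part z).

(* Main.v *)
(** All atoms only involve forms [a x + s] with [a] a constant and [s] an affine
    term in the other variables, that is, orders and classes of [x - c_j] for
    finitely many affine centres [c_j]. Let [c] be the centre nearest to [x]. By
    the ultrametric inequality these data are determined by the class of
    [u = x - c] modulo a subgroup [(K^x)^N (1 + pi^M R_K)] and by the position
    of [ord u] among the orders of finitely many affine terms [d]. Since the
    residue field is finite and the value group is a Z-group, the subgroup has
    finite index, and the class and position of [u] are realised by some [r d]
    with [r] in a finite set of constants. Hence finitely many affine terms
    [c + r d] suffice as witnesses for an existential quantifier; this gives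
    quantifier elimination and, iterating, finitely many tuples of terms among
    which the first one that works is a definable choice. *)

Require Import Defs.
From HB Require Import structures.
From mathcomp Require Import all_boot all_order all_algebra.
From mathcomp Require Import ring boolp.

Set Implicit Arguments.
Unset Strict Implicit.
Unset Printing Implicit Defensive.

Import GRing.Theory.
Local Open Scope ring_scope.

Lemma seq_has_min (T : eqType) (r : rel T) (s : seq T) (a0 : T) :
  total r -> transitive r -> a0 \in s ->
  exists2 a, a \in s & {in s, forall b, r a b}.
Proof.
move=> r_total r_trans; rewrite -(mem_sort r).
have := sort_sorted r_total s; have := mem_sort r s.
case: (sort r s) => // a t mem_s /(order_path_min r_trans)/allP min_a _.
exists a => [|b]; rewrite -mem_s ?mem_head // inE => /predU1P[->|/min_a//].
by have := r_total a a; rewrite orbb.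
Qed.

(** * Terms and formulas *)

HB.instance Definition _ (K : fieldType) := gen_eqMixin (term K).
HB.instance Definition _ (K : fieldType) := gen_eqMixin (formula K).

Section Terms.

Variable K : fieldType.
Implicit Types (e : nat -> K) (i k : nat) (t : term K) (ts : seq (term K)).

Definition upd_from e k (s : seq K) i : K :=
  if (i < k)%N then e i else s`_(i - k).

Fixpoint tsub (sigma : nat -> term K) t : term K :=
  match t with
  | TVar i => sigma i
  | TConst c => TConst c
  | TAdd t1 t2 => TAdd (tsub sigma t1) (tsub sigma t2)
  | TSub t1 t2 => TSub (tsub sigma t1) (tsub sigma t2)
  | TScal c t1 => TScal c (tsub sigma t1)
  end.

Definition subst_at i t j : term K := if j == i then t else TVar K j.

Definition subst_from k ts i : term K :=
  if (i < k)%N then TVar K i else nth (TConst 0) ts (i - k).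

Fixpoint coef i t : K :=
  match t with
  | TVar j => (j == i)%:R
  | TConst _ => 0
  | TAdd t1 t2 => coef i t1 + coef i t2
  | TSub t1 t2 => coef i t1 - coef i t2
  | TScal c t1 => c * coef i t1
  end.

Definition free_part i : term K -> term K := tsub (subst_at i (TConst 0)).

Lemma upd_ext e e' i a : e =1 e' -> upd e i a =1 upd e' i a.
Proof. by move=> ee' j; rewrite /upd ee'. Qed.

Lemma upd_from_cons e k a s :
  upd_from e k (a :: s) =1 upd_from (upd e k a) k.+1 s.
Proof.
move=> i; rewrite /upd_from /upd ltnS; case: ltngtP => //= [ki|->].
  by rewrite -(subnSK ki).
by rewrite subnn.
Qed.

Lemma teval_ext e e' t : e =1 e' -> teval e t = teval e' t.
Proof. by move=> ee'; elim: t => //= [t1 -> t2 ->|t1 -> t2 ->|c t ->]. Qed.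

Lemma teval_tsub e sigma t :
  teval e (tsub sigma t) = teval (fun i => teval e (sigma i)) t.
Proof. by elim: t => //= [t1 -> t2 ->|t1 -> t2 ->|c t ->]. Qed.

Lemma teval_subst_at e i t :
  (fun j => teval e (subst_at i t j)) =1 upd e i (teval e t).
Proof. by move=> j; rewrite /subst_at /upd; case: eqP. Qed.

Lemma teval_subst_from e k ts :
  (fun i => teval e (subst_from k ts i)) =1 upd_from e k (map (teval e) ts).
Proof.
move=> i; rewrite /subst_from /upd_from; case: ifP => // _.
by elim: ts (i - k)%N => [|t ts IHts] [|j] /=.
Qed.

Lemma teval_upd e i a t :
  teval (upd e i a) t = coef i t * a + teval e (free_part i t).
Proof.
elim: t => /= [j|c|t1 -> t2 ->|t1 -> t2 ->|c t ->]; try by ring.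
by rewrite /upd /free_part /= /subst_at; case: eqP => _ /=; ring.
Qed.

End Terms.

Section Formulas.

Variables (K : fieldType) (G : zmodType) (le : rel G) (ord : K -> option G).
Variable pi : K.
Implicit Types (e : nat -> K) (f g : formula K).

Local Notation sat := (sat le ord pi).

Lemma sat_ext f e e' : e =1 e' -> sat e f <-> sat e' f.
Proof.
elim: f e e' => [t1 t2|t1 t2|n m t1 t2 t3|f IHf|f IHf g IHg|f IHf g IHg
  |i f IHf|i f IHf] e e' ee' /=; try by rewrite !(teval_ext _ ee').
- by rewrite (IHf _ _ ee').
- by rewrite (IHf _ _ ee') (IHg _ _ ee').
- by rewrite (IHf _ _ ee') (IHg _ _ ee').
- by split=> -[a fa]; exists a; apply/(IHf _ _ (upd_ext i a ee')).
- by split=> fa a; apply/(IHf _ _ (upd_ext i a ee')).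
Qed.

Fixpoint qf f : bool :=
  match f with
  | FEq _ _ | FDiv _ _ | FR _ _ _ _ _ => true
  | FNot f1 => qf f1
  | FAnd f1 f2 | FOr f1 f2 => qf f1 && qf f2
  | FEx _ _ | FAll _ _ => false
  end.

(* Only meaningful on quantifier-free formulas: bound variables are not renamed
   and quantified formulas are left unchanged. *)
Fixpoint fsub (sigma : nat -> term K) f : formula K :=
  match f with
  | FEq t1 t2 => FEq (tsub sigma t1) (tsub sigma t2)
  | FDiv t1 t2 => FDiv (tsub sigma t1) (tsub sigma t2)
  | FR n m t1 t2 t3 => FR n m (tsub sigma t1) (tsub sigma t2) (tsub sigma t3)
  | FNot f1 => FNot (fsub sigma f1)
  | FAnd f1 f2 => FAnd (fsub sigma f1) (fsub sigma f2)
  | FOr f1 f2 => FOr (fsub sigma f1) (fsub sigma f2)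
  | FEx _ _ | FAll _ _ => f
  end.

Lemma sat_fsub e sigma f :
  qf f -> sat e (fsub sigma f) <-> sat (fun i => teval e (sigma i)) f.
Proof.
elim: f => //= [t1 t2|t1 t2|n m t1 t2 t3|f IHf|f IHf g IHg|f IHf g IHg].
- by rewrite !teval_tsub.
- by rewrite !teval_tsub.
- by rewrite !teval_tsub.
- by move=> /IHf ->.
- by move=> /andP[/IHf -> /IHg ->].
- by move=> /andP[/IHf -> /IHg ->].
Qed.

Lemma qf_fsub sigma f : qf (fsub sigma f) = qf f.
Proof. by elim: f => //= f -> g ->. Qed.

Definition is_atom f : bool :=
  match f with FEq _ _ | FDiv _ _ | FR _ _ _ _ _ => true | _ => false end.

Fixpoint atoms f : seq (formula K) :=
  match f with
  | FNot f1 => atoms f1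
  | FAnd f1 f2 | FOr f1 f2 => atoms f1 ++ atoms f2
  | FEx _ _ | FAll _ _ => [::]
  | _ => [:: f]
  end.

Lemma mem_atoms f a : a \in atoms f -> is_atom a.
Proof.
have /allP : all is_atom (atoms f); last exact.
by elim: f => //= f IHf g IHg; rewrite all_cat IHf.
Qed.

Lemma sat_atoms e e' f : qf f ->
  {in atoms f, forall a, sat e a <-> sat e' a} -> sat e f <-> sat e' f.
Proof.
elim: f => //= [t1 t2|t1 t2|n m t1 t2 t3|f IHf|f IHf g IHg|f IHf g IHg].
- by move=> _ ee'; apply: (ee' _ (mem_head _ _)).
- by move=> _ ee'; apply: (ee' _ (mem_head _ _)).
- by move=> _ ee'; apply: (ee' _ (mem_head _ _)).
- by move=> qff /(IHf qff) ->.
- by move=> /andP[qff qfg] ee'; rewrite IHf ?IHg // => a a_in;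
    apply: ee'; rewrite mem_cat a_in ?orbT.
- by move=> /andP[qff qfg] ee'; rewrite IHf ?IHg // => a a_in;
    apply: ee'; rewrite mem_cat a_in ?orbT.
Qed.

Definition atom_terms f : seq (term K) :=
  match f with
  | FEq t1 t2 => [:: TSub t1 t2]
  | FDiv t1 t2 => [:: t1; t2]
  | FR _ _ t1 t2 t3 => [:: TSub t2 t1; t3]
  | _ => [::]
  end.

Definition atom_modulus f : nat := if f is FR n _ _ _ _ then n.+1 else 1%N.

Definition atom_precision f : nat := if f is FR _ m _ _ _ then m.+1 else 0%N.

Definition ffalse : formula K := FNot (FEq (TConst 0) (TConst 0)).

Definition bigor (s : seq (formula K)) : formula K := foldr (@FOr K) ffalse s.

Definition bigand (s : seq (formula K)) : formula K :=
  foldr (@FAnd K) (FNot ffalse) s.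

Lemma sat_bigor (A : eqType) e (F : A -> formula K) (s : seq A) :
  sat e (bigor (map F s)) <-> exists2 a, a \in s & sat e (F a).
Proof.
elim: s => [|a s IHs] /=; first by split=> [[]|[]].
rewrite IHs; split=> [[Fa|[b bs Fb]]|[b]].
- by exists a; rewrite ?mem_head.
- by exists b; rewrite // inE bs orbT.
- by rewrite inE => /predU1P[->|bs] Fb; [left | right; exists b].
Qed.

Lemma sat_bigand (A : eqType) e (F : A -> formula K) (s : seq A) :
  sat e (bigand (map F s)) <-> {in s, forall a, sat e (F a)}.
Proof.
elim: s => [|a s IHs] /=; first by split=> // _; apply.
rewrite IHs; split=> [[Fa Fs] b|Fs].
  by rewrite inE => /predU1P[->//|/Fs].
by split=> [|b bs]; apply: Fs; rewrite inE ?eqxx // bs orbT.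
Qed.

Lemma qf_bigor (A : Type) (F : A -> formula K) (s : seq A) :
  (forall a, qf (F a)) -> qf (bigor (map F s)).
Proof. by move=> qfF; elim: s => //= a s ->; rewrite qfF. Qed.

End Formulas.

Arguments sat_ext {K G le ord pi f e e'} ee'.

(** * Valuations *)

Section Valuation.

Variables (K : fieldType) (G : zmodType) (le : rel G) (ord : K -> option G).
Hypotheses (zgroup : ZGroup le) (valued : is_valuation le ord).

Local Notation vle x y := (ole le (ord x) (ord y)).
Local Notation vlt x y := (~~ vle y x).

Let leG_refl x : le x x.
Proof. by case: zgroup => -[+ _] *; apply. Qed.

Let leG_trans x y z : le x y -> le y z -> le x z.
Proof. by case: zgroup => -[_ trans] *; apply: (trans x y z). Qed.

Let leG_anti x y : le x y -> le y x -> x = y.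
Proof. by case: zgroup => _ anti *; apply: anti. Qed.

Let leG_total x y : le x y \/ le y x.
Proof. by case: zgroup => _ _ + *; apply. Qed.

Let leG_add2r z x y : le (x + z) (y + z) = le x y.
Proof.
have add2r t a b : le a b -> le (a + t) (b + t).
  by case: zgroup => _ _ _ + *; apply.
by apply/idP/idP => [/(add2r (- z))|/add2r//]; rewrite !addrK.
Qed.

Lemma ordM x y : ord (x * y) = oadd (ord x) (ord y).
Proof. by case: valued => _ + _ _; apply. Qed.

Lemma ord_zero : ord 0 = None.
Proof. by case: valued => /(_ 0)[_ ->]. Qed.

Lemma ord_neq0 x : x != 0 -> exists g, ord x = Some g.
Proof.
case Ex : (ord x) => [g|]; first by exists g.
by case: valued => /(_ x)[/(_ Ex) ->]; rewrite eqxx.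
Qed.

Lemma ord_Some_neq0 x g : ord x = Some g -> x != 0.
Proof. by move=> Ex; apply/eqP => x0; rewrite x0 ord_zero in Ex. Qed.

Lemma ord_one : ord 1 = Some 0.
Proof.
have [g Eg] := ord_neq0 (oner_neq0 K).
have := ordM 1 1; rewrite mulr1 Eg /= => -[gg].
by congr Some; apply: (addrI g); rewrite -gg addr0.
Qed.

Lemma ordX x g n : ord x = Some g -> ord (x ^+ n) = Some (g *+ n).
Proof.
move=> Ex; elim: n => [|n IHn]; first by rewrite expr0 ord_one.
by rewrite exprS ordM Ex IHn /= mulrS.
Qed.

Lemma ordMr x u : ord u = Some 0 -> ord (x * u) = ord x.
Proof.
by move=> u1; rewrite ordM u1; case: (ord x) => //= g; rewrite addr0.
Qed.

Lemma ordMl x u : ord u = Some 0 -> ord (u * x) = ord x.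
Proof. by move=> u1; rewrite mulrC ordMr. Qed.

Lemma ord_mulVl c x : c != 0 -> ord x = ord c -> ord (c^-1 * x) = Some 0.
Proof. by move=> nc xc; rewrite ordM xc -ordM mulVf // ord_one. Qed.

Lemma ordV u : ord u = Some 0 -> ord u^-1 = Some 0.
Proof.
move=> u1; rewrite -[u^-1]mulr1; apply: ord_mulVl; last by rewrite ord_one.
exact: ord_Some_neq0 u1.
Qed.

Lemma vlexx x : vle x x.
Proof. by case: (ord x) => /=. Qed.

Lemma vle_trans y x z : vle x y -> vle y z -> vle x z.
Proof.
by case: (ord x) (ord y) (ord z) => [a|] [b|] [c|] //=; apply: leG_trans.
Qed.

Lemma vle_total x y : vle x y || vle y x.
Proof. by case: (ord x) (ord y) => [a|] [b|] //=; apply/orP. Qed.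

Lemma vltW x y : vlt x y -> vle x y.
Proof. by move=> /negPf xy; have := vle_total x y; rewrite xy orbF. Qed.

Lemma vle_lt_trans y x z : vle x y -> vlt y z -> vlt x z.
Proof. by move=> xy; apply: contra => zx; apply: vle_trans xy. Qed.

Lemma vlt_le_trans y x z : vlt x y -> vle y z -> vlt x z.
Proof. by move=> + yz; apply: contra; apply: vle_trans. Qed.

Lemma vle_anti x y : vle x y -> vle y x -> ord x = ord y.
Proof.
by case: (ord x) (ord y) => [a|] [b|] //= ab ba; congr Some; apply: leG_anti.
Qed.

Lemma exists_vle_min (T : eqType) (F : T -> K) (s : seq T) (a0 : T) :
  a0 \in s -> exists2 a, a \in s & {in s, forall b, vle (F a) (F b)}.
Proof.
apply: (@seq_has_min _ [rel a b | vle (F a) (F b)]) => [a b|b a c].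
  exact: vle_total.
exact: vle_trans.
Qed.

Lemma exists_vle_max (T : eqType) (F : T -> K) (s : seq T) (a0 : T) :
  a0 \in s -> exists2 a, a \in s & {in s, forall b, vle (F b) (F a)}.
Proof.
apply: (@seq_has_min _ [rel a b | vle (F b) (F a)]) => [a b|b a c /= ba cb].
  exact: vle_total.
exact: vle_trans cb ba.
Qed.

Lemma vlex0 x : vle x 0.
Proof. by rewrite ord_zero; case: (ord x). Qed.

Lemma vle0x x : vle 0 x = (x == 0).
Proof.
have [->|nx] := eqVneq x 0; first exact: vlex0.
by rewrite ord_zero; have [g ->] := ord_neq0 nx.
Qed.

Lemma vle_pM2l c x y : c != 0 -> vle (c * x) (c * y) = vle x y.
Proof.
move=> /ord_neq0[g Eg]; rewrite !ordM Eg.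
by case: (ord x) (ord y) => [a|] [b|] //=; rewrite ![g + _]addrC leG_add2r.
Qed.

Lemma vle_M2l c x y : vle x y -> vle (c * x) (c * y).
Proof.
by have [->|nc] := eqVneq c 0; [rewrite !mul0r vlexx | rewrite vle_pM2l].
Qed.

Lemma vleM x y z t : vle x y -> vle z t -> vle (x * z) (y * t).
Proof.
move=> xy zt; apply: (@vle_trans (x * t)); first exact: vle_M2l.
by rewrite ![_ * t]mulrC; apply: vle_M2l.
Qed.

Lemma vleX x y n : vle x y -> vle (x ^+ n) (y ^+ n).
Proof.
by move=> xy; elim: n => [|n IHn]; rewrite ?expr0 ?vlexx // !exprS vleM.
Qed.

Lemma vleX1 x n : vle 1 x -> vle 1 (x ^+ n).
Proof. by move=> /(vleX n); rewrite expr1n. Qed.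

Lemma vle_mull x c : vle 1 c -> vle x (c * x).
Proof. by move=> c1; rewrite -{1}[x]mul1r vleM ?vlexx. Qed.

(* [vle 1 (-1)] and [vle (-1) 1] are exchanged by multiplication by [-1]. *)
Lemma vleN z x : vle z x -> vle z (- x).
Proof.
have le1N1 : vle 1 (-1).
  have /orP[//|/(vle_M2l (-1))] := vle_total 1 (-1).
  by rewrite mulr1 mulrNN mulr1.
by move=> zx; have := vleM zx le1N1; rewrite mulr1 mulrN1.
Qed.

Lemma vleD z x y : vle z x -> vle z y -> vle z (x + y).
Proof.
move=> zx zy; case: valued => _ _ /(_ x y)/orP[] h _.
  exact: vle_trans zx h.
exact: vle_trans zy h.
Qed.

Lemma vleB z x y : vle z x -> vle z y -> vle z (x - y).
Proof. by move=> zx zy; apply/vleD/vleN. Qed.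

Definition same_pos d u u' := vle d u = vle d u' /\ vle u d = vle u' d.

Lemma same_pos_above d u u' : vlt d u -> vlt d u' -> same_pos d u u'.
Proof.
by move=> du du'; rewrite /same_pos (negPf du) (negPf du') (vltW du) (vltW du').
Qed.

Lemma same_pos_below d u u' : vlt u d -> vlt u' d -> same_pos d u u'.
Proof.
by move=> ud u'd; rewrite /same_pos (negPf ud) (negPf u'd) (vltW ud) (vltW u'd).
Qed.

Lemma same_pos_between (ds : seq K) d u u' :
  {in ds, forall d', vle d' u -> vle d' d} -> vlt d u -> vlt d u' -> vle u' u ->
  {in ds, forall d', same_pos d' u u'}.
Proof.
move=> d_max du du' u'u d' d'_ds.
have [/(d_max _ d'_ds) d'd|ud'] := boolP (vle d' u).
  by apply: same_pos_above; [exact: vle_lt_trans du | exact: vle_lt_trans du'].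
by apply: same_pos_below => //; apply: vle_lt_trans ud'.
Qed.

Lemma same_posM2l c d u u' :
  c != 0 -> same_pos (c^-1 * d) u u' -> same_pos d (c * u) (c * u').
Proof. by move=> nc [? ?]; rewrite /same_pos -(mulVKf nc d) !vle_pM2l. Qed.

Section Uniformizer.

Variable pi : K.
Hypothesis unif : uniformizer le ord pi.

Local Notation cong := (congr_pim le ord pi).

Lemma pi_neq0 : pi != 0.
Proof. by case: unif => e [/ord_Some_neq0]. Qed.

Lemma piX_neq0 n : pi ^+ n != 0.
Proof. by rewrite expf_neq0 ?pi_neq0. Qed.

Lemma vlt1pi : vlt 1 pi.
Proof.
case: unif => e [Ee e0 e1 _]; rewrite ord_one Ee /=.
by apply/negP => h; case: e1; apply: leG_anti.
Qed.

Lemma vlt_pi x y : vlt x y -> vle (pi * x) y.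
Proof.
have [->|nx] := eqVneq x 0; first by rewrite vlex0.
have [->|ny] := eqVneq y 0; first by rewrite vlex0.
have [[a Ea] [b Eb]] := (ord_neq0 nx, ord_neq0 ny).
case: unif => e [Ee _ _ e_min]; rewrite ordM Ea Eb Ee /= => nba.
have ab : le a b by have [//|ba] := leG_total a b; rewrite ba in nba.
rewrite -[b](subrK a) leG_add2r; apply: e_min.
  by rewrite -(subrr a) leG_add2r.
by move=> /subr0_eq Eba; rewrite Eba leG_refl in nba.
Qed.

Lemma vle1_piX n : vle 1 (pi ^+ n).
Proof. exact/vleX1/vltW/vlt1pi. Qed.

Lemma vlt1_piX n : (0 < n)%N -> vlt 1 (pi ^+ n).
Proof.
case: n => // n _; apply: (vlt_le_trans vlt1pi).
by rewrite exprSr vle_mull ?vle1_piX.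
Qed.

Lemma vle_piX m n : (m <= n)%N -> vle (pi ^+ m) (pi ^+ n).
Proof. by move=> mn; rewrite -(subnK mn) exprD vle_mull ?vle1_piX. Qed.

Lemma vlt_piX m n : (m < n)%N -> vlt (pi ^+ m) (pi ^+ n).
Proof.
move=> mn; rewrite -(subnKC (ltnW mn)) exprD -{2}[pi ^+ m]mulr1.
by rewrite vle_pM2l ?piX_neq0 // vlt1_piX ?subn_gt0.
Qed.

Lemma ord_eq_piXM n w u : vle w u -> vlt u (pi ^+ n * w) ->
  exists2 j, (j < n)%N & ord u = ord (pi ^+ j * w).
Proof.
move=> wu; elim: n => [|n IHn]; first by rewrite expr0 mul1r wu.
move=> u_lt; have [le_u|/IHn[j jn Eu]] := boolP (vle (pi ^+ n * w) u).
  exists n => //; apply: vle_anti => //.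
  by apply: contraR u_lt => /vlt_pi; rewrite exprS mulrA.
by exists j => //; apply: leqW.
Qed.

Lemma ordX_eq1 t n : (0 < n)%N -> ord (t ^+ n) = Some 0 -> ord t = Some 0.
Proof.
move=> n0; rewrite -ord_one => tn1.
apply: vle_anti; apply: contraT => /vlt_pi/(vleX n).
  by rewrite mulr1 tn1 => /(vlt_le_trans (vlt1_piX n0)); rewrite vlexx.
rewrite expr1n exprMn ordM tn1 -ordM mulr1.
by move=> /(vlt_le_trans (vlt1_piX n0)); rewrite vlexx.
Qed.

Lemma cong_refl m a : cong m a a.
Proof. by rewrite /congr_pim subrr vlex0. Qed.

Lemma cong_sym m a b : cong m a b -> cong m b a.
Proof. by move=> /vleN; rewrite opprB. Qed.

Lemma cong_trans m a b c : cong m a b -> cong m b c -> cong m a c.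
Proof. by move=> ab /(vleD ab); rewrite addrA subrK. Qed.

Lemma congM2l m a b c : vle 1 c -> cong m a b -> cong m (c * a) (c * b).
Proof. by move=> c1 /(vleM c1); rewrite mul1r mulrBr. Qed.

Lemma congM2r m a b c : vle 1 c -> cong m a b -> cong m (a * c) (b * c).
Proof. by rewrite ![_ * c]mulrC; apply: congM2l. Qed.

Lemma congW m n a b : (m <= n)%N -> cong n a b -> cong m a b.
Proof. by move=> mn; apply/vle_trans/vle_piX. Qed.

Lemma cong1_integral m v : cong m v 1 -> vle 1 v.
Proof.
move=> v1; rewrite -[v](subrK 1); apply: vleD; last exact: vlexx.
exact: vle_trans (vle1_piX m) v1.
Qed.

Lemma cong1_unit m v : (0 < m)%N -> cong m v 1 -> ord v = Some 0.
Proof.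
move=> m0 v1; rewrite -ord_one; apply: vle_anti; last exact: cong1_integral v1.
apply: contraT => /vlt_pi; rewrite mulr1 => pi_v.
have pi1 : vle pi (v - (v - 1)).
  by apply: vleB => //; have := congW m0 v1; rewrite /congr_pim expr1.
by move: vlt1pi; rewrite subKr in pi1; rewrite pi1.
Qed.

Lemma cong1_neq0 m v : (0 < m)%N -> cong m v 1 -> v != 0.
Proof. by move=> m0 /(cong1_unit m0)/ord_Some_neq0. Qed.

Lemma cong1M m v w : cong m v 1 -> cong m w 1 -> cong m (v * w) 1.
Proof.
move=> v1 w1; apply: (cong_trans _ w1); rewrite -{2}[w]mul1r.
exact: congM2r (cong1_integral w1) v1.
Qed.

Lemma cong1X m v n : cong m v 1 -> cong m (v ^+ n) 1.
Proof.
move=> v1; elim: n => [|n IHn]; first exact: cong_refl.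
by rewrite exprS; apply: cong1M.
Qed.

Lemma cong_unit_div m w s :
  ord w = Some 0 -> cong m s w -> cong m (w^-1 * s) 1.
Proof.
move=> w1 sw; rewrite -(mulVf (ord_Some_neq0 w1)).
by apply: congM2l sw; rewrite ordV // ord_one /=.
Qed.

Lemma cong1V m v : (0 < m)%N -> cong m v 1 -> cong m v^-1 1.
Proof.
move=> m0 v1; rewrite -[v^-1]mulr1.
exact: cong_unit_div (cong1_unit m0 v1) (cong_sym v1).
Qed.

Lemma power_decomposition n x : (0 < n)%N -> x != 0 -> exists i t w,
  [/\ (i < n)%N, t != 0, ord w = Some 0 & x = pi ^+ i * t ^+ n * w].
Proof.
move=> n0 nx; have [g Eg] := ord_neq0 nx.
case: zgroup => _ _ _ _ [e [e0 e1 e_min /(_ n n0 g)[h [i [lt_in Eh]]]]].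
have Ee : ord pi = Some e.
  by case: unif => e' [-> *]; congr Some; apply: leG_anti; auto.
case: valued => _ _ _ /(_ h)[t Et]; have nt := ord_Some_neq0 Et.
have npt : pi ^+ i * t ^+ n != 0 by rewrite mulf_neq0 ?piX_neq0 ?expf_neq0.
exists i, t, ((pi ^+ i * t ^+ n)^-1 * x); split; rewrite ?mulVKf //.
by apply: ord_mulVl; rewrite // Eg ordM (ordX _ Ee) (ordX _ Et) /= addrC -Eh.
Qed.

Lemma rho_eq_sym n m x y :
  rho_eq le ord pi n m x y -> rho_eq le ord pi n m y x.
Proof.
case=> [[-> ->]|[nx ny [a [b [z [Ea Eb Ez]]]] ac_xy]]; first by left.
right; split=> // [|ac /ac_xy/cong_sym//].
by exists b, a, (- z); rewrite mulNrn -Ez opprB.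
Qed.

Lemma rho_eq_trans n m y x z : rho_eq le ord pi n m x y ->
  rho_eq le ord pi n m y z -> rho_eq le ord pi n m x z.
Proof.
case=> [[-> ->]|[nx ny [a [b [s [Ea Eb Es]]]] ac_xy]].
  by case=> [[_ ->]|[]]; [left | rewrite eqxx].
case=> [[y0]|[_ nz [b' [c [t [Eb' Ec Et]]]] ac_yz]].
  by rewrite y0 eqxx in ny.
right; split=> // [|ac ac_m]; last first.
  exact: cong_trans (ac_xy _ ac_m) (ac_yz _ ac_m).
exists a, c, (s + t); split=> //; rewrite mulrnDl -Es -Et.
by move: Eb'; rewrite Eb => -[->]; rewrite addrA subrK.
Qed.

Lemma ac_specX m ac t n : ac_spec le ord pi m ac -> t != 0 ->
  cong m (ac (t ^+ n)) (ac t ^+ n).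
Proof.
case=> ac_unit acM _ ac_congr nt; elim: n => [|n IHn].
  by rewrite !expr0; apply/ac_congr/ord_one.
rewrite !exprS; apply: cong_trans (acM _ _ nt _) _; first by rewrite expf_neq0.
by apply: congM2l IHn; rewrite ac_unit // ord_one /=.
Qed.

Section FiniteResidueField.

Variable q : nat.
Hypothesis finite_residue : residue_field_Fq le ord q.

Lemma residue_reps : exists S : seq K,
  forall x, vle 1 x -> exists2 s, s \in S & cong 1 x s.
Proof.
case: finite_residue => F [res [_ resD _ res_surj res0]].
have [f fP] := fin_all_exists res_surj; rewrite /in_RK -ord_one in resD res0 fP.
exists (codom f) => x x1; exists (f (res x)); first exact: codom_f.
have [fx1 res_fx] := fP (res x).
have d1 : vle 1 (x - f (res x)) by apply: vleB.
rewrite /congr_pim expr1 -[pi]mulr1; apply/vlt_pi/(res0 _ d1).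
have := resD _ _ d1 fx1; rewrite subrK res_fx => res_x.
by apply: (addIr (res x)); rewrite -res_x add0r.
Qed.

Lemma residue_repsX m : exists S : seq K,
  forall x, vle 1 x -> exists2 s, s \in S & cong m x s.
Proof.
have [S1 S1P] := residue_reps; elim: m => [|m [S SP]].
  by exists [:: 0] => x x1; exists 0; rewrite ?mem_head // /congr_pim subr0.
exists [seq s + pi ^+ m * t | s <- S, t <- S1] => x /SP[s sS xs].
set y := (pi ^+ m)^-1 * (x - s).
have Ey : x - s = pi ^+ m * y by rewrite mulVKf ?piX_neq0.
have [|t tS1 yt] := S1P y.
  by rewrite -(vle_pM2l _ _ (piX_neq0 m)) mulr1 -Ey.
exists (s + pi ^+ m * t); first exact: allpairs_f.
by rewrite /congr_pim opprD addrA Ey -mulrBr exprSr; apply: vle_M2l.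
Qed.

(* Two of the powers [w^0, ..., w^N] agree modulo [pi^m] when there are only
   [N] residues. *)
Lemma unit_exponent m : exists2 n, (0 < n)%N &
  forall w, ord w = Some 0 -> cong m (w ^+ n) 1.
Proof.
have [S SP] := residue_repsX m; exists (size S)`!; first exact: fact_gt0.
move=> w w1; have nw := ord_Some_neq0 w1.
have w_int i : vle 1 (w ^+ i) by apply: vleX1; rewrite w1 ord_one /=.
have [f fS wf] := fin_all_exists2 (fun i : 'I_(size S).+1 => SP _ (w_int i)).
have [i [j [lt_ij fij]]] : exists i j : 'I_(size S).+1, (i < j)%N /\ f i = f j.
  have /injectivePn[i [j]] : ~~ injectiveb f.
    apply: contraTN (ltnSn (size S)) => f_inj; rewrite -leqNgt.
    rewrite -{1}(size_enum_ord (size S).+1) -(size_map f).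
    by apply: uniq_leq_size => [//|_ /mapP[i _ ->]].
  by rewrite neq_ltn => /orP[lt_ij|lt_ji] fij; [exists i, j | exists j, i].
have ji_S : (0 < j - i <= size S)%N.
  by rewrite subn_gt0 lt_ij (leq_trans (leq_subr _ _)) // -ltnS.
rewrite -(divnK (dvdn_fact ji_S)) mulnC exprM; apply: cong1X.
have -> : w ^+ (j - i) = (w ^+ i)^-1 * w ^+ j.
  by rewrite -{2}(subnKC (ltnW lt_ij)) exprD mulKf ?expf_neq0.
apply: cong_unit_div; first by rewrite (ordX _ w1) mul0rn.
by apply: cong_trans (wf j) _; rewrite -fij; apply/cong_sym/wf.
Qed.

(** * Cosets of powers and principal units *)

Section PowerClasses.

Variables N M : nat.
Hypotheses (N_gt0 : (0 < N)%N) (M_gt0 : (0 < M)%N).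
Hypothesis unitXN : forall w, ord w = Some 0 -> cong M (w ^+ N) 1.

(* Cosets of (K^x)^N (1 + pi^M R_K): they refine every [rho_eq n m] with [n]
   dividing [N] and [m <= M], whether or not angular components exist. *)
Definition class_eq x y :=
  exists t v, [/\ t != 0, cong M v 1 & x = y * t ^+ N * v].

Lemma class_eq_refl x : class_eq x x.
Proof.
by exists 1, 1; rewrite oner_neq0 expr1n !mulr1; split=> //; apply: cong_refl.
Qed.

Lemma class_eq_sym x y : class_eq x y -> class_eq y x.
Proof.
case=> t [v [nt v1 ->]]; exists t^-1, v^-1.
have nv := cong1_neq0 M_gt0 v1.
split; [by rewrite invr_neq0 | exact: cong1V |].
by rewrite exprVn; field; rewrite nv expf_neq0.
Qed.

Lemma class_eq_trans y x z : class_eq x y -> class_eq y z -> class_eq x z.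
Proof.
case=> t [v [nt v1 ->]] [s [w [ns w1 ->]]]; exists (s * t), (w * v).
by split; [exact: mulf_neq0 | exact: cong1M | rewrite exprMn; ring].
Qed.

Lemma class_eqM2l c x y : class_eq x y -> class_eq (c * x) (c * y).
Proof. by case=> t [v [nt v1 ->]]; exists t, v; rewrite !mulrA. Qed.

Lemma class_eqM1 x v : cong M v 1 -> class_eq (x * v) x.
Proof. by move=> v1; exists 1, v; rewrite oner_neq0 expr1n mulr1. Qed.

Lemma class_eq_eq0 x y : class_eq x y -> (x == 0) = (y == 0).
Proof.
case=> t [v [nt v1 ->]]; rewrite !mulf_eq0 (negPf (cong1_neq0 M_gt0 v1)).
by rewrite expf_eq0 (negPf nt) andbF !orbF.
Qed.

Lemma class_eq_same_ord x y :
  class_eq x y -> ord x = ord y -> exists2 v, cong M v 1 & x = y * v.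
Proof.
move=> [t [v [nt v1 ->]]] Exy; have [->|ny] := eqVneq y 0.
  by exists 1; [exact: cong_refl | rewrite !mul0r].
exists (t ^+ N * v); last by rewrite mulrA.
apply: cong1M => //; apply/unitXN/(ordX_eq1 N_gt0).
rewrite ordMr ?(cong1_unit M_gt0 v1) // in Exy.
by have := ord_mulVl ny Exy; rewrite mulKf.
Qed.

Lemma class_eq_gap x y : class_eq y x -> vlt x y -> vle (pi ^+ N * x) y.
Proof.
move=> [t [v [_ v1 ->]]]; rewrite ordMr ?(cong1_unit M_gt0 v1) // => x_lt.
have /vlt_pi : vlt 1 t.
  by apply: contra x_lt => /(vleX N)/(vle_M2l x); rewrite expr1n mulr1.
by rewrite mulr1 mulrC => /(vleX N)/vle_M2l.
Qed.

Lemma class_eqD a b :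
  vle (pi ^+ M * a) b -> class_eq (a + b) a /\ ord (a + b) = ord a.
Proof.
have [->|na] := eqVneq a 0.
  rewrite mulr0 vle0x => /eqP ->; rewrite addr0.
  by split=> //; apply: class_eq_refl.
move=> ab; have v1 : cong M (1 + a^-1 * b) 1.
  by rewrite /congr_pim addrAC subrr add0r -(vle_pM2l _ _ na) mulVKf // mulrC.
have -> : a + b = a * (1 + a^-1 * b) by rewrite mulrDr mulr1 mulVKf.
by split; [exact: class_eqM1 | rewrite ordMr ?(cong1_unit M_gt0 v1)].
Qed.

Lemma class_eq_ac m ac x y : (m <= M)%N -> ac_spec le ord pi m ac ->
  y != 0 -> class_eq x y -> cong m (ac x) (ac y).
Proof.
move=> mM ac_m ny [t [v [nt v1 ->]]]; have [ac_unit acM _ ac_congr] := ac_m.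
have ac_int z : z != 0 -> vle 1 (ac z).
  by move=> nz; rewrite ac_unit // ord_one /=.
have nv := cong1_neq0 M_gt0 v1; have ntN : t ^+ N != 0 by rewrite expf_neq0.
have nytN : y * t ^+ N != 0 by rewrite mulf_neq0.
have acv1 : cong m (ac v) 1.
  by apply: cong_trans (ac_congr _ (cong1_unit M_gt0 v1)) (congW mM v1).
apply: cong_trans (acM _ _ nytN nv) _.
apply: cong_trans (congM2l (ac_int _ nytN) acv1) _; rewrite mulr1.
apply: cong_trans (acM _ _ ny ntN) _; rewrite -{2}[ac y]mulr1.
apply/(congM2l (ac_int _ ny))/(cong_trans (ac_specX N ac_m nt)).
exact/(congW mM)/unitXN/ac_unit.
Qed.

Lemma class_eq_rho_eq n m x y : (n %| N)%N -> (m <= M)%N -> class_eq x y ->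
  rho_eq le ord pi n m x y.
Proof.
move=> nN mM xy; have [y0|ny] := eqVneq y 0.
  by left; split=> //; apply/eqP; rewrite (class_eq_eq0 xy) y0.
have nx : x != 0 by rewrite (class_eq_eq0 xy).
right; split=> // [|ac ac_m]; last exact: class_eq_ac xy.
have [[a Ea] [b Eb]] := (ord_neq0 nx, ord_neq0 ny).
case: xy Ea => t [v [/ord_neq0[c Ec] v1 ->]] Ea.
exists a, b, (c *+ (N %/ n)); split=> //; rewrite -mulrnA divnK //.
move: Ea; rewrite ordMr ?(cong1_unit M_gt0 v1) // ordM Eb (ordX _ Ec) /=.
by move=> -[<-]; rewrite addrC addKr.
Qed.

(** * Test points *)

Lemma class_reps : exists R : seq K, forall b u, b != 0 -> u != 0 ->
  exists2 r, r \in R & [/\ class_eq (r * b) u, vle b (r * b),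
    vlt (r * b) (pi ^+ N * b) & vle b u -> vle (r * b) u].
Proof.
have [S SP] := residue_repsX M.
exists [seq pi ^+ i * s | i <- iota 0 N, s <- S] => b u nb nu.
have [|i [t [w [iN nt w1 Eu]]]] :=
    power_decomposition N_gt0 (_ : b^-1 * u != 0).
  by rewrite mulf_neq0 ?invr_neq0.
have [|s sS ws] := SP w; first by rewrite w1 ord_one /=.
have v1 := cong_unit_div w1 (cong_sym ws).
have nw := ord_Some_neq0 w1; have ntN : t ^+ N != 0 by rewrite expf_neq0.
have s1 : ord s = Some 0.
  by rewrite -(mulVKf nw s) ordMl ?(cong1_unit M_gt0 v1).
have ord_r : ord (pi ^+ i * s) = ord (pi ^+ i) by rewrite ordMr.
have r_u : class_eq (pi ^+ i * s * b) u.
  exists t^-1, (w^-1 * s); split; rewrite ?invr_neq0 //.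
  by rewrite -(mulVKf nb u) Eu exprVn; field; rewrite nw ntN.
have r_ub : vlt (pi ^+ i * s * b) (pi ^+ N * b).
  by rewrite ![_ * b]mulrC vle_pM2l // ord_r vlt_piX.
exists (pi ^+ i * s); first by apply: allpairs_f; rewrite ?mem_iota.
split=> // [|bu]; first by rewrite vle_mull // ord_r vle1_piX.
apply: contraR r_ub => /(class_eq_gap r_u); apply: vle_trans.
exact: vle_M2l.
Qed.

Lemma class_reps_scaled (A : seq K) : exists R : seq K, forall a b u,
  a \in A -> a != 0 -> b != 0 -> u != 0 ->
  exists2 r, r \in R & [/\ class_eq (r * b) u, vle (a * b) (r * b),
    vlt (r * b) (pi ^+ N * (a * b)) & vle (a * b) u -> vle (r * b) u].
Proof.
have [R RP] := class_reps; exists [seq r * a | r <- R, a <- A].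
move=> a b u aA na nb nu; have [r rR rP] := RP _ _ (mulf_neq0 na nb) nu.
by exists (r * a); [exact: allpairs_f | rewrite -mulrA].
Qed.

(* The representative is a bounded multiple of the largest element of [ds] below
   [u] or, if there is none, of the smallest element of [ds]. *)
Lemma position_reps : exists R : seq K, forall (ds : seq K) d0 u,
  d0 \in ds -> d0 != 0 -> u != 0 -> exists r d, [/\ r \in R, d \in ds,
    class_eq (r * d) u & {in ds, forall d', same_pos d' u (r * d)}].
Proof.
have piN := piX_neq0 N.
have [R RP] := class_reps_scaled [:: 1; pi; (pi ^+ N)^-1].
exists R => ds d0 u d0_ds nd0 nu.
have [/hasP[d1 d1_ds d1u]|none_below] := boolP (has (fun d => vle d u) ds).
  have [|d] := exists_vle_max id (_ : d1 \in [seq d <- ds | vle d u]).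
    by rewrite mem_filter d1u.
  rewrite mem_filter => /andP[du d_ds] d_max.
  have nd : d != 0 by apply: contra nu => /eqP d_0; rewrite -vle0x -d_0.
  have [ud|lt_du] := boolP (vle u d).
    have [||r rR [r_u]] := RP 1 d u _ _ nd nu; rewrite ?mem_head ?oner_neq0 //.
    rewrite mul1r => d_rd _ /(_ du) rd_u.
    have Erd : ord (r * d) = ord u by apply/vle_anti/(vle_trans ud).
    by exists r, d; split=> // d' _; rewrite /same_pos Erd.
  have [|r rR [r_u pid_rd _ /(_ (vlt_pi lt_du)) rd_u]] :=
      RP pi d u _ pi_neq0 nd nu.
    by rewrite !inE eqxx orbT.
  have lt_drd : vlt d (r * d).
    by apply: vlt_le_trans pid_rd; rewrite mulrC -{2}[d]mulr1 vle_pM2l ?vlt1pi.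
  exists r, d; split=> //.
  apply: same_pos_between lt_du lt_drd rd_u => d' d'_ds d'u.
  by apply: d_max; rewrite mem_filter d'u.
have [d d_ds d_min] := exists_vle_min id d0_ds.
have nd : d != 0.
  by apply: contra nd0 => /eqP d_0; rewrite -vle0x -d_0; apply: d_min.
have [||r rR [r_u _ lt_rd _]] := RP (pi ^+ N)^-1 d u _ _ nd nu.
- by rewrite !inE eqxx !orbT.
- by rewrite invr_neq0.
rewrite mulVKf // in lt_rd; exists r, d; split=> // d' d'_ds.
apply: same_pos_below; last exact: vlt_le_trans (d_min _ d'_ds).
by apply: contra none_below => d'u; apply/hasP; exists d'.
Qed.

Definition agree (I : eqType) (L : seq I) (f g : I -> K) :=
  {in L, forall i, class_eq (g i) (f i)} /\
  {in L &, forall i j, vle (f i) (f j) = vle (g i) (g j)}.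

Lemma class_eq_affine_same_ord a h u u' :
  class_eq u' u -> ord u' = ord u -> vle (a * u + h) (a * u) ->
  class_eq (a * u' + h) (a * u + h) /\ ord (a * u' + h) = ord (a * u + h).
Proof.
move=> u'u Eu'u h_u; have [v v1 ->] := class_eq_same_ord u'u Eu'u.
have -> : a * (u * v) + h = (a * u + h) + (v - 1) * (a * u) by ring.
exact/class_eqD/vleM.
Qed.

(* Unless [ord (a * u)] is within distance [M] of [ord h], one of the two terms
   governs [a * u + h]; hence the exponents [j - M] between [-M] and [M]. *)
Lemma class_eq_affine_diff_ord a h u u' :
  class_eq u' u -> ord u' <> ord u ->
  (forall j, (j < (M + M).+1)%N -> same_pos (pi ^+ j / pi ^+ M / a * h) u u') ->
  class_eq (a * u' + h) (a * u + h) /\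
  ([/\ a != 0, ord (a * u + h) = ord (a * u)
     & ord (a * u' + h) = ord (a * u')] \/
   ord (a * u + h) = ord h /\ ord (a * u' + h) = ord h).
Proof.
move=> u'u Eu'u pos; have [->|na] := eqVneq a 0.
  by rewrite !mul0r add0r; split; [exact: class_eq_refl | right].
have npiM := piX_neq0 M; pose d := (pi ^+ M)^-1 * (a^-1 * h).
have {}pos j : (j < (M + M).+1)%N -> same_pos (pi ^+ j * d) u u'.
  by move=> /pos; rewrite !mulrA.
have [above|below] := boolP (vle (pi ^+ (M + M) * d) u).
  have small x : vle (pi ^+ (M + M) * d) x -> vle (pi ^+ M * h) (a * x).
    rewrite exprD -mulrA mulVKf // => /(vle_M2l a).
    by rewrite mulrCA mulVKf.
  have above' : vle (pi ^+ (M + M) * d) u' by case: (pos _ (ltnSn _)) => <-.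
  have [hu ?] := class_eqD (small _ above).
  have [hu' ?] := class_eqD (small _ above').
  rewrite ![_ + h]addrC; split; last by right.
  exact/(class_eq_trans hu')/class_eq_sym.
have [d_u|lt_ud] := boolP (vle d u).
  have [j lt_j Ej] := ord_eq_piXM d_u below; case: Eu'u.
  have [pos1 pos2] := pos j (ltnW lt_j).
  by apply: vle_anti; rewrite Ej -?pos1 -?pos2 Ej vlexx.
have small x : vle x d -> vle (pi ^+ M * (a * x)) h.
  move=> /(vle_M2l a)/(vle_M2l (pi ^+ M)).
  by rewrite mulrCA [a * d]mulrCA mulVKf // mulVKf.
have u'd : vle u' d.
  by case: (pos 0%N isT) => _; rewrite expr0 mul1r => <-; apply: vltW.
have [uh ?] := class_eqD (small _ (vltW lt_ud)).
have [uh' ?] := class_eqD (small _ u'd).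
split; last by left.
apply: class_eq_trans uh' _; apply: class_eq_trans (class_eqM2l a u'u) _.
exact: class_eq_sym.
Qed.

Definition scales (A : seq K) : seq K :=
  [seq pi ^+ j / pi ^+ M / a | j <- iota 0 (M + M).+1, a <- A].

(* The hypothesis on [a i * u + h i] says that no zero of these forms is nearer
   to [u] than 0. *)
Lemma agree_centered (I : eqType) (L : seq I) (a h : I -> K) u u' :
  class_eq u' u -> {in L, forall i, vle (a i * u + h i) (a i * u)} ->
  (forall z i, z \in scales (map a L) -> i \in L -> same_pos (z * h i) u u') ->
  agree L (fun i => a i * u + h i) (fun i => a i * u' + h i).
Proof.
move=> u'u centered pos; have [Eu'u|Eu'u] := eqVneq (ord u') (ord u).
  have affine i (iL : i \in L) :=
    class_eq_affine_same_ord u'u Eu'u (centered i iL).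
  by split=> [i /affine[]//|i j /affine[_ ->] /affine[_ ->]].
have pos_self i : i \in L -> forall j, (j < (M + M).+1)%N ->
    same_pos (pi ^+ j / pi ^+ M / a i * h i) u u'.
  move=> iL j jM; apply: pos => //.
  by apply: allpairs_f; rewrite ?mem_iota ?map_f.
have affine i (iL : i \in L) :=
  class_eq_affine_diff_ord u'u (elimN eqP Eu'u) (pos_self i iL).
have pos_h i j : i \in L -> j \in L -> a i != 0 ->
    same_pos (h j) (a i * u) (a i * u').
  move=> iL jL nai; apply/(same_posM2l nai)/(pos _ j) => //.
  have -> : (a i)^-1 = pi ^+ M / pi ^+ M / a i.
    by rewrite divff ?piX_neq0 ?mul1r.
  by apply: allpairs_f; [rewrite mem_iota ltnS leq_addr | exact: map_f].
have nu : u != 0.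
  apply: contraNneq Eu'u => u0.
  by move: (class_eq_eq0 u'u); rewrite u0 eqxx => /eqP ->.
have nu' : u' != 0 by rewrite (class_eq_eq0 u'u).
split=> [i /affine[]//|i j iL jL].
have [[_ ord_i] [_ ord_j]] := (affine i iL, affine j jL).
case: ord_i => [[nai -> ->]|[-> ->]]; case: ord_j => [[naj -> ->]|[-> ->]] //.
- by rewrite ![_ * u]mulrC ![_ * u']mulrC !vle_pM2l.
- by have [] := pos_h i j iL jL nai.
- by have [] := pos_h j i jL iL naj.
Qed.

Lemma agreeS (I : eqType) (L L' : seq I) (f g : I -> K) :
  {subset L' <= L} -> agree L f g -> agree L' f g.
Proof.
by move=> sub [cls pos]; split; [exact: sub_in1 cls | exact: sub_in2 pos].
Qed.

Definition centre_terms i (L : seq (term K)) : seq (term K) :=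
  TConst 0 :: [seq TScal (- (coef i t)^-1) (free_part i t) | t <- L].

Definition offset i c t : term K := TAdd (TScal (coef i t) c) (free_part i t).

Definition critical_terms i (L : seq (term K)) c : seq (term K) :=
  TConst 1 ::
  [seq TScal z (offset i c t) | z <- scales (map (coef i) L), t <- L].

Lemma teval_upd_centre e i c y : teval (upd e i (y + teval e c)) =
  fun t => coef i t * y + teval e (offset i c t).
Proof. by apply/funext => t; rewrite teval_upd /=; ring. Qed.

Lemma nearest_centre e i (L : seq (term K)) x :
  exists2 c, c \in centre_terms i L & let u := x - teval e c in
    {in L, forall t,
      vle (coef i t * u + teval e (offset i c t)) (coef i t * u)}.
Proof.
have [c cC c_max] := exists_vle_max (fun c => x - teval e c)
  (mem_head (TConst 0) [seq TScal (- (coef i t)^-1) (free_part i t) | t <- L]).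
exists c => // u t tL; have [->|nt] := eqVneq (coef i t) 0.
  by rewrite !mul0r vlex0.
have -> : coef i t * u + teval e (offset i c t) =
    coef i t * (x - teval e (TScal (- (coef i t)^-1) (free_part i t))).
  by rewrite /u /=; field.
by rewrite vle_pM2l //; apply: c_max; rewrite inE map_f ?orbT.
Qed.

Lemma test_terms i (L : seq (term K)) : exists T : seq (term K), forall e x,
  exists2 t, t \in T &
    agree L (teval (upd e i x)) (teval (upd e i (teval e t))).
Proof.
have [R RP] := position_reps; pose C := centre_terms i L.
pose D c := [seq TScal r d | r <- R, d <- critical_terms i L c].
exists (C ++ [seq TAdd d c | c <- C, d <- D c]) => e x.
have [c cC centered] := nearest_centre e i L x; set u := x - _ in centered.
have [u0|nu] := eqVneq u 0.
  exists c; rewrite ?mem_cat ?cC // -(subr0_eq u0).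
  by split=> // t _; apply: class_eq_refl.
have [|r [_ [rR /mapP[d dD ->] u'u pos]]] :=
  RP [seq teval e d | d <- critical_terms i L c] 1 u _ (oner_neq0 _) nu.
  by rewrite mem_head.
exists (TAdd (TScal r d) c).
  by rewrite mem_cat (allpairs_f_dep _ cC) ?orbT // allpairs_f.
rewrite -[x](subrK (teval e c)) -/u /= !teval_upd_centre.
apply: agree_centered => // z t z_in tL.
have crit : TScal z (offset i c t) \in critical_terms i L c.
  by rewrite inE allpairs_f ?orbT.
exact: pos (map_f (teval e) crit).
Qed.

Lemma sat_atom_agree e e' a : is_atom a -> (atom_modulus a %| N)%N ->
  (atom_precision a <= M)%N -> agree (atom_terms a) (teval e) (teval e') ->
  sat le ord pi e a <-> sat le ord pi e' a.
Proof.
case: a => //= [t1 t2|t1 t2|n m t1 t2 t3] _ nN mM [cls pos].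
- have := class_eq_eq0 (cls _ (mem_head _ _)); rewrite /= !subr_eq0 => eq12.
  by split=> /eqP; [rewrite -eq12 | rewrite eq12] => /eqP.
- by rewrite pos ?inE ?eqxx ?orbT.
have rho t : t \in [:: TSub t2 t1; t3] ->
    rho_eq le ord pi n.+1 m.+1 (teval e' t) (teval e t).
  by move=> /cls; apply: class_eq_rho_eq.
have /= rho21 := rho _ (mem_head _ _).
have rho3 : rho_eq le ord pi n.+1 m.+1 (teval e' t3) (teval e t3).
  by apply: rho; rewrite !inE eqxx orbT.
split=> rho123.
  exact: rho_eq_trans rho21 (rho_eq_trans rho123 (rho_eq_sym rho3)).
exact: rho_eq_trans (rho_eq_sym rho21) (rho_eq_trans rho123 rho3).
Qed.

End PowerClasses.

(** * Quantifier elimination *)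

Local Notation sat := (sat le ord pi).

Lemma witness_terms i f : qf f -> exists T : seq (term K), forall e x,
  sat (upd e i x) f -> exists2 t, t \in T & sat (upd e i (teval e t)) f.
Proof.
move=> qff; pose M := (\max_(a <- atoms f) atom_precision a).+1.
have [n n_gt0 unitXn] := unit_exponent M.
pose N := (n * \prod_(a <- atoms f) atom_modulus a)%N.
have N_gt0 : (0 < N)%N by rewrite muln_gt0 n_gt0 prodn_gt0 // => -[].
have unitXN w : ord w = Some 0 -> cong M (w ^+ N) 1.
  by move=> w1; rewrite exprM; apply/cong1X/unitXn.
have [T TP] := test_terms N_gt0 (ltn0Sn _) unitXN i
  (flatten [seq atom_terms a | a <- atoms f]).
exists T => e x; have [t tT xt] := TP e x; exists t => //.
apply: (iffLR (sat_atoms qff _)); last eassumption.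
move=> a af; apply: (sat_atom_agree (ltn0Sn _) unitXN (mem_atoms af)).
- by rewrite /N (big_rem a) //= dvdn_mull // dvdn_mulr.
- exact/leqW/leq_bigmax_seq.
- by apply: agreeS xt => u ua; apply/flatten_mapP; exists a.
Qed.

Lemma qe_ex i f : qf f -> exists2 g, qf g &
  forall e, sat e g <-> exists x, sat (upd e i x) f.
Proof.
move=> qff; have [T TP] := witness_terms i qff.
exists (bigor [seq fsub (subst_at i t) f | t <- T]).
  by apply: qf_bigor => t; rewrite qf_fsub.
move=> e; rewrite sat_bigor; split=> [[t _]|[x /TP[t tT ft]]].
  rewrite sat_fsub // (sat_ext (teval_subst_at e i t)).
  by exists (teval e t).
exists t => //; rewrite sat_fsub //.
exact/(sat_ext (teval_subst_at e i t)).
Qed.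

Lemma quantifier_elimination f :
  exists2 g, qf g & forall e, sat e f <-> sat e g.
Proof.
elim: f => [t1 t2|t1 t2|n m t1 t2 t3|f [f' qff' ff']
  |f [f' qff' ff'] g [g' qfg' gg']|f [f' qff' ff'] g [g' qfg' gg']
  |i f [f' qff' ff']|i f [f' qff' ff']].
- by exists (FEq t1 t2).
- by exists (FDiv t1 t2).
- by exists (FR n m t1 t2 t3).
- by exists (FNot f') => // e /=; rewrite ff'.
- by exists (FAnd f' g') => /= [|e]; rewrite ?qff' // ff' gg'.
- by exists (FOr f' g') => /= [|e]; rewrite ?qff' // ff' gg'.
- have [h qfh hP] := qe_ex i qff'; exists h => // e; rewrite hP /=.
  by split=> -[x fx]; exists x; apply/ff'.
- have [//|h qfh hP] := @qe_ex i (FNot f').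
  exists (FNot h) => // e /=; rewrite hP /=; split=> [fx [x]|nfx x].
    by case; apply/ff'.
  by apply/ff'; apply: contrapT => nx; apply: nfx; exists x.
Qed.

Lemma skolem_terms r k f : qf f -> exists tss : seq (r.-tuple (term K)),
  forall e (s : r.-tuple K), sat (upd_from e k s) f ->
    exists2 ts, ts \in tss & sat (upd_from e k (map (teval e) ts)) f.
Proof.
move=> qff; elim: r k => [|r IHr] k.
  by exists [:: [tuple]] => e s; rewrite tuple0; exists [tuple].
have [tss tssP] := IHr k.+1.
have satP e ts : sat e (fsub (subst_from k.+1 ts) f) <->
    sat (upd_from e k.+1 (map (teval e) ts)) f.
  by rewrite sat_fsub //; apply/sat_ext/teval_subst_from.
pose f' := bigor [seq fsub (subst_from k.+1 ts) f | ts : r.-tuple _ <- tss].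
have [|T TP] := @witness_terms k f'.
  by apply: qf_bigor => ts; rewrite qf_fsub.
pose cons_tuple t (ts : r.-tuple (term K)) : r.+1.-tuple (term K) :=
  [tuple of t :: map (tsub (subst_at k t)) ts].
exists [seq cons_tuple t ts | t <- T, ts <- tss].
move=> e /tupleP[x s] /(sat_ext (upd_from_cons e k x s))/tssP[ts ts_tss fts].
have /TP[t tT] : sat (upd e k x) f'.
  by apply/sat_bigor; exists ts => //; apply/satP.
move=> /sat_bigor[us us_tss /satP fus].
exists (cons_tuple t us); first exact: allpairs_f.
rewrite /= -map_comp; apply/(sat_ext (upd_from_cons e k _ _)).
rewrite (eq_map (g := teval (upd e k (teval e t)))) // => u /=.
by rewrite teval_tsub; apply/teval_ext/teval_subst_at.
Qed.

End FiniteResidueField.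
End Uniformizer.
End Valuation.

(** * Definable choice *)

Lemma cat_parts (T : Type) (a b : nat) (z : (a + b).-tuple T) :
  [tuple of fst_part z ++ snd_part z] = z.
Proof.
apply: eq_from_tnth => i; case: (split_ordP i) => j ->.
  by rewrite tnth_lshift tnth_mktuple.
by rewrite tnth_rshift tnth_mktuple.
Qed.

Lemma fst_part_cat (T : Type) (a b : nat) (x : a.-tuple T) (y : b.-tuple T) :
  fst_part [tuple of x ++ y] = x.
Proof. by apply: eq_from_tnth => i; rewrite tnth_mktuple tnth_lshift. Qed.

Section DefinableChoice.

Variables (K : fieldType) (G : zmodType) (le : rel G) (ord : K -> option G).
Variables (pi : K) (k r : nat) (f : formula K).
Hypothesis qff : qf f.

Local Notation sat := (sat le ord pi).

Implicit Types (y : k.-tuple K) (ts : r.-tuple (term K)).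

Lemma tenv_cat n y (s : n.-tuple K) :
  tenv [tuple of y ++ s] =1 upd_from (tenv y) k s.
Proof. by move=> i; rewrite /tenv nth_cat size_tuple. Qed.

Lemma tenv_fst_part n (z : (k + n).-tuple K) (s : seq K) :
  upd_from (tenv z) k s =1 upd_from (tenv (fst_part z)) k s.
Proof.
move=> i; rewrite /upd_from; case: ifP => // ik.
by rewrite -{1}[z]cat_parts tenv_cat /upd_from ik.
Qed.

Lemma upd_from_nil y : upd_from (tenv y) k [::] =1 tenv y.
Proof.
move=> i; rewrite /upd_from /tenv; case: ltnP => // ki.
by rewrite !nth_default ?size_tuple.
Qed.

Definition point y ts : (k + r).-tuple K :=
  [tuple of y ++ [seq teval (tenv y) t | t <- ts]].

(* The terms [ts] are meant to be evaluated with the variables from [k] on set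
   to 0, whereas in the graph these hold the remaining coordinates. *)
Definition point_subst ts : nat -> term K :=
  subst_from k [seq tsub (subst_from k [::]) t | t <- ts].

Lemma teval_point_subst n (z : (k + n).-tuple K) ts :
  (fun i => teval (tenv z) (point_subst ts i)) =1 tenv (point (fst_part z) ts).
Proof.
move=> i; rewrite teval_subst_from tenv_fst_part tenv_cat -map_comp.
congr (upd_from _ _ _ _); apply: eq_map => t /=.
rewrite teval_tsub; apply: teval_ext => j.
by rewrite teval_subst_from tenv_fst_part upd_from_nil.
Qed.

Definition witnessed y ts : bool := `[< sat (tenv (point y ts)) f >].

Definition first_witness (tss : seq (r.-tuple (term K))) y : (k + r).-tuple K :=
  point y (nth [tuple TConst 0 | _ < r] tss (find (witnessed y) tss)).

Lemma sat_first_witness tss y :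
  has (witnessed y) tss -> sat (tenv (first_witness tss y)) f.
Proof. by move=> /(nth_find [tuple TConst 0 | _ < r])/asboolP. Qed.

Definition graph_eq ts : formula K :=
  bigand [seq FEq (TVar K (k + i)) (point_subst ts i) | i <- iota 0 (k + r)].

Lemma sat_graph_eq (z : (k + (k + r)).-tuple K) ts :
  sat (tenv z) (graph_eq ts) <-> snd_part z = point (fst_part z) ts.
Proof.
have tenv_z i : tenv z (k + i) = tenv (snd_part z) i.
  by rewrite -{1}[z]cat_parts tenv_cat /upd_from ltnNge leq_addr addKn.
have -> : sat (tenv z) (graph_eq ts) <-> {in iota 0 (k + r), forall i,
    tenv (snd_part z) i = tenv (point (fst_part z) ts) i}.
  rewrite sat_bigand.
  by split=> eq_z i /eq_z; rewrite /= tenv_z teval_point_subst.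
split=> [eq_z|-> //]; apply: eq_from_tnth => i; rewrite !(tnth_nth 0).
by apply: eq_z; rewrite mem_iota /=.
Qed.

Fixpoint graph_formula (tss : seq (r.-tuple (term K))) : formula K :=
  if tss is ts :: tss' then
    let g := fsub (point_subst ts) f in
    FOr (FAnd g (graph_eq ts)) (FAnd (FNot g) (graph_formula tss'))
  else ffalse K.

Lemma sat_graph_formula tss (z : (k + (k + r)).-tuple K) :
  sat (tenv z) (graph_formula tss) <->
  has (witnessed (fst_part z)) tss /\
  snd_part z = first_witness tss (fst_part z).
Proof.
have satP ts : sat (tenv z) (fsub (point_subst ts) f) <->
    sat (tenv (point (fst_part z) ts)) f.
  by rewrite sat_fsub //; apply/sat_ext/teval_point_subst.
elim: tss => [|ts tss IHtss] /=; first by split=> [[]|[]].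
rewrite satP sat_graph_eq IHtss /first_witness /= /witnessed.
case: asboolP => fts /=; first by split=> [[[]|[]]//|[_ ->]]; left.
by split=> [[[]//|[]//]|]; right.
Qed.

End DefinableChoice.

Theorem mainTheorem11 (q : nat) (K : fieldType) (G : zmodType) (le : rel G)
  (ord : K -> option G) (HK : FqZField le ord q)
  (pi : K) (Hpi : uniformizer le ord pi)
  (k r : nat) (X : (k + r).-tuple K -> Prop)
  (HX : definable le ord pi X) :
  exists g : k.-tuple K -> (k + r).-tuple K,
    definable le ord pi (graph_on X g) /\
    (forall y : k.-tuple K, proj_set X y -> X (g y) /\ proj_k (g y) = y).
Proof.
case: HK HX => zgroup valued finite_residue [f0 f0P].
have [f qff ff0] := quantifier_elimination zgroup valued Hpi finite_residue f0.
have XP x : X x <-> sat le ord pi (tenv x) f by rewrite f0P ff0.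
have [tss tssP] := skolem_terms zgroup valued Hpi finite_residue r k qff.
pose g (y : k.-tuple K) := first_witness le ord pi f tss y.
have projX y : proj_set X y <-> has (witnessed le ord pi f y) tss.
  split=> [[x [/XP Xx <-]]|/sat_first_witness Xy]; last first.
    by exists (g y); split; [exact/XP | exact: fst_part_cat].
  have [|ts ts_tss fts] := tssP (tenv (fst_part x)) (snd_part x).
    by apply/(sat_ext (tenv_cat _ _)); rewrite cat_parts.
  apply/hasP; exists ts => //; apply/asboolP.
  exact/(sat_ext (tenv_cat _ _)).
exists g; split=> [|y /projX/sat_first_witness Xy].
  exists (graph_formula k f tss) => z.
  by rewrite sat_graph_formula // /graph_on projX.
by split; [exact/XP | exact: fst_part_cat].
Qed.
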